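(* Consider full Dubins networks on three terminals in the plane, with fixed weights $w_1,w_2,w_3>0$ such that the angle $\alpha$ at the Steiner point between the first and second paths satisfies $0<\alpha<\pi$. Suppose that the first two terminals $\mathbf{p}_1,\mathbf{p}_2$ are fixed and the third terminal $\mathbf{p}_3$ is varied. Then the Steiner point traces out a limaçon. That is, for each choice of Dubins circles at $\mathbf{p}_1$ and $\mathbf{p}_2$ and each cyclic order of the three edges around the Steiner point, there is a limaçon in the plane such that, for every directed point $\mathbf{p}_3$, the Steiner point of any full Dubins network on $\mathbf{p}_1,\mathbf{p}_2,\mathbf{p}_3$ with this choice of Dubins circles and this cyclic order lies on that limaçon.
   Context: A directed point is a pair $\mathbf{p}=(p,\vec p)$ with $p\in\mathbb{R}^2$ and $\vec p$ a tangent vector at $p$. The minimum radius of curvature is normalised to $\rho=1$. Given three directed points $\mathbf{p}_1,\mathbf{p}_2,\mathbf{p}_3$ (the terminals), a network interconnecting them is admissible if: (i) it is continuously differentiable except at any Steiner point (a vertex of the network other than a terminal); (ii) it interconnects $p_1,p_2,p_3$ and has tangent vectors $\vec p_1,\vec p_2,\vec p_3$ at these points respectively; (iii) it is piecewise twice differentiable, with only finitely many points at which the curvature is not defined; (iv) where the curvature exists it is at most $\rho^{-1}=1$. A path of type $CS$ from a terminal to the Steiner point consists of an arc of a circle of radius $1$ starting at the terminal with the prescribed direction, followed by a straight segment (of positive length) tangent to the circle and ending at the Steiner point. The two circles of radius $1$ through $p_i$ tangent to $\vec p_i$ are the Dubins circles at $\mathbf{p}_i$; the arc of a $CS$ path lies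 on one of them, and the choice of Dubins circle determines whether the arc is traversed clockwise or counterclockwise when leaving $p_i$ in direction $\vec p_i$. For weights $w_i>0$ and a network consisting of three paths of lengths $L_i$ joining the $i$th terminal to a common Steiner point, the weighted length is $\sum_{i=1}^3 w_iL_i$ (the unweighted case is $w_1=w_2=w_3=1$). A Dubins network is an admissible network that is a local minimum of the weighted length, in the sense that its weighted length cannot be reduced by a small perturbation of the Steiner point together with a correspondingly small modification of the paths, keeping the network admissible. A full Dubins network on three terminals is a Dubins network consisting of three paths of type $CS$ from the terminals, meeting at a single Steiner point. In such a network the angles at the Steiner point are those of the Fermat–Weber problem with the same weights; in particular the angle $\alpha$ between the first and second paths depends only on the weights: $\alpha=\pi-\arccos\left(\frac{w_1^2+w_2^2-w_3^2}{2w_1w_2}\right)$ (so $\alpha=2\pi/3$ in the unweighted case). A limaçon is a plane curve which, in a suitable polar coordinate system $(r,\theta)$ (with $r$ allowed to be negative), has an equation $r=b+a\cos\theta$ with real constants $a,b$, $b\neq 0$ (the degenerate case $a=0$, a circle, is allowed). *)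

(* Defs.v *)
From Stdlib Require Export Reals List.
From Coquelicot Require Export Coquelicot.
Open Scope R_scope.

Definition plane : Type := (R * R)%type.

Definition padd (u v : plane) : plane := (fst u + fst v, snd u + snd v).
Definition psub (u v : plane) : plane := (fst u - fst v, snd u - snd v).
Definition pscal (k : R) (v : plane) : plane := (k * fst v, k * snd v).
Definition pnorm (v : plane) : R := sqrt (fst v ^ 2 + snd v ^ 2).
Definition pdist (u v : plane) : R := pnorm (psub u v).
Definition polar (r theta : R) : plane := (r * cos theta, r * sin theta).
(* Counterclockwise rotation by [theta]. *)
Definition rot (theta : R) (v : plane) : plane :=
  (cos theta * fst v - sin theta * snd v, sin theta * fst v + cos theta * snd v).

Inductive index : Type := I1 | I2 | I3.

Definition triple {A : Type} (a1 a2 a3 : A) (i : index) : A :=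
  match i with I1 => a1 | I2 => a2 | I3 => a3 end.

Record dpoint : Type := DPoint {
  pos : plane;
  tan_vec : plane;
  tan_vec_neq0 : tan_vec <> (0, 0)
}.

(* Only the direction of the tangent vector matters. *)
Definition udir (p : dpoint) : plane := pscal (/ pnorm (tan_vec p)) (tan_vec p).

(* A curve parametrised by arc length on [0, len]. The function [pt] is total,
   but only its restriction to [0, len] is meaningful: asking below for two-sided
   derivatives at 0 and [len] loses nothing, since a curve that is C^1 up to its
   endpoints extends to a C^1 one by its tangent lines. *)
Record path : Type := Path { len : R; pt : R -> plane }.

Definition vel (g : path) (t : R) : plane :=
  (Derive (fun u => fst (pt g u)) t, Derive (fun u => snd (pt g u)) t).

Definition acc (g : path) (t : R) : plane :=
  (Derive_n (fun u => fst (pt g u)) 2 t, Derive_n (fun u => snd (pt g u)) 2 t).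

Definition diff_at (g : path) (t : R) : Prop :=
  ex_derive (fun u => fst (pt g u)) t /\ ex_derive (fun u => snd (pt g u)) t.

Definition twice_diff_at (g : path) (t : R) : Prop :=
  ex_derive_n (fun u => fst (pt g u)) 2 t /\ ex_derive_n (fun u => snd (pt g u)) 2 t.

Definition vel_continuous_at (g : path) (t : R) : Prop :=
  continuous (fun u => fst (vel g u)) t /\ continuous (fun u => snd (vel g u)) t.

(* At unit speed the curvature is the norm of the second derivative. The curve is
   C^1 up to its Steiner endpoint as well: this is automatic, because bounded
   curvature makes the unit tangent Lipschitz. *)
Definition admissible_path (p : dpoint) (s : plane) (g : path) : Prop :=
  0 < len g /\
  (forall t, 0 <= t <= len g ->
     diff_at g t /\ vel_continuous_at g t /\ pnorm (vel g t) = 1) /\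
  (exists l : list R, forall t, 0 < t < len g -> ~ In t l -> twice_diff_at g t) /\
  (forall t, 0 < t < len g -> twice_diff_at g t -> pnorm (acc g t) <= 1) /\
  pt g 0 = pos p /\ vel g 0 = udir p /\ pt g (len g) = s.

Record network : Type := Network { steiner : plane; branch : index -> path }.

Definition admissible (P : index -> dpoint) (N : network) : Prop :=
  (forall i, steiner N <> pos (P i)) /\
  (forall i, admissible_path (P i) (steiner N) (branch N i)).

Definition weighted_length (w : index -> R) (N : network) : R :=
  w I1 * len (branch N I1) + w I2 * len (branch N I2) + w I3 * len (branch N I3).

(* C^1-closeness, after rescaling the arc-length parameter of both paths to [0, 1]. *)
Definition close_path (eps : R) (g h : path) : Prop :=
  forall t, 0 <= t <= 1 ->
    pdist (pt g (len g * t)) (pt h (len h * t)) < eps /\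
    pdist (vel g (len g * t)) (vel h (len h * t)) < eps.

Definition close_network (eps : R) (N M : network) : Prop :=
  pdist (steiner N) (steiner M) < eps /\
  forall i, close_path eps (branch N i) (branch M i).

Definition dubins_network (w : index -> R) (P : index -> dpoint) (N : network) : Prop :=
  admissible P N /\
  exists eps, 0 < eps /\
    forall M, admissible P M -> close_network eps N M ->
      weighted_length w N <= weighted_length w M.

(* [Left]: the Dubins circle lies to the left of the directed point, so that it is
   traversed counterclockwise when leaving in the prescribed direction. *)
Inductive side : Type := Left | Right.

Definition sgn (sd : side) : R := match sd with Left => 1 | Right => -1 end.

Definition dubins_center (p : dpoint) (sd : side) : plane :=
  padd (pos p) (rot (sgn sd * (PI / 2)) (udir p)).

Definition dubins_arc (p : dpoint) (sd : side) (t : R) : plane :=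
  padd (dubins_center p sd) (rot (sgn sd * t) (psub (pos p) (dubins_center p sd))).

Definition dubins_tangent (p : dpoint) (sd : side) (t : R) : plane :=
  rot (sgn sd * t) (udir p).

(* The arc may be reduced to a point ([phi = 0]); the segment may not. *)
Definition CS_path (p : dpoint) (sd : side) (g : path) : Prop :=
  exists phi, 0 <= phi < 2 * PI /\ phi < len g /\
    (forall t, 0 <= t <= phi -> pt g t = dubins_arc p sd t) /\
    (forall t, phi <= t <= len g ->
       pt g t = padd (dubins_arc p sd phi) (pscal (t - phi) (dubins_tangent p sd phi))).

Definition full_dubins_network (w : index -> R) (P : index -> dpoint) (N : network) : Prop :=
  dubins_network w P N /\ forall i, exists sd, CS_path (P i) sd (branch N i).

(* [acos] is clamped outside [-1, 1], so [0 < alpha w < PI] says exactly that its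
   argument lies strictly between -1 and 1. *)
Definition alpha (w : index -> R) : R :=
  PI - acos ((w I1 ^ 2 + w I2 ^ 2 - w I3 ^ 2) / (2 * w I1 * w I2)).

(* Unit tangent of the [i]-th edge at the Steiner point, pointing away from it. *)
Definition edge_dir (N : network) (i : index) : plane :=
  pscal (-1) (vel (branch N i) (len (branch N i))).

Definition ccw_triple (u1 u2 u3 : plane) : Prop :=
  exists t1 t2 t3, t1 < t2 < t3 /\ t3 < t1 + 2 * PI /\
    u1 = polar 1 t1 /\ u2 = polar 1 t2 /\ u3 = polar 1 t3.

(* Counterclockwise order of the edges around the Steiner point. *)
Inductive cyclic_order : Type := Order123 | Order132.

Definition has_cyclic_order (o : cyclic_order) (N : network) : Prop :=
  match o with
  | Order123 => ccw_triple (edge_dir N I1) (edge_dir N I2) (edge_dir N I3)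
  | Order132 => ccw_triple (edge_dir N I1) (edge_dir N I3) (edge_dir N I2)
  end.

(* [r = b + a cos theta] for the polar coordinates with pole [o] and axis at angle
   [psi] to the x-axis. *)
Definition limacon (K : plane -> Prop) : Prop :=
  exists (o : plane) (psi a b : R), b <> 0 /\
    forall q, K q <-> exists theta, q = padd o (polar (b + a * cos theta) (theta + psi)).

(* Main.v *)
Require Import Defs.
From Stdlib Require Import Lra.

(** Two facts pin down the Steiner point.

    Equilibrium.  If each branch can follow a displacement [t * d] of the Steiner
    point at the cost [t * (v . d) + o(t)], where [v] is the velocity with which
    it arrives, then local minimality gives [0 <= sum_i w_i (v_i . d)] for every
    [d], hence [sum_i w_i u_i = 0] for the edge directions [u_i = - v_i]
    ([full_dubins_equilibrium]; one displacement along the resultant itself is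
    enough).  Such a variation of a branch is obtained without touching its arc:
    just before the segment, a short unit arc on the side of [d] is inserted
    ([branch_variation]).  This works equally when the original arc is reduced
    to a point.  All curves are described by their heading, an angle varying at
    rate at most 1: the velocity is the unit vector with that heading, so
    admissibility and closeness of curves become statements about
    real functions.  The equilibrium and the cyclic order give the oriented
    angle between the first two edges, [alpha w] or [- alpha w] ([edge_angle]).

    Geometry.  The segments of the first two branches lie on oriented lines
    tangent to two fixed unit circles, the circle lying on a known side
    ([CS_path_tangency]), and these lines make a fixed angle.  If [eta] is the
    direction of the first one, solving the two linear equations shows that
    their common point is the sum of a fixed point, a fixed vector turned by
    [2 * eta] and a fixed nonzero vector turned by [eta]
    ([tangent_lines_meet_on_limacon]).  (For lines through two fixed points the
    last vector would vanish, and the inscribed angle theorem gives a circle.)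
    Such a curve is a limacon ([limacon_of_rotations]), because
    [b e^(i x) + a cos x e^(i x) = b e^(i x) + (a/2) e^(2 i x) + a/2]. *)

(** * One-sided derivatives and Lipschitz bounds *)

(** The sign [s] selects the side of [x] on which the minimum is known. *)
Lemma derive_sign_at_one_sided_min (f : R -> R) (x l s d : R) :
  s = 1 \/ s = -1 -> is_derive f x l -> 0 < d ->
  (forall h, 0 < h < d -> f x <= f (x + s * h)) -> 0 <= s * l.
Proof.
  intros Hs Hf Hd Hmin.
  apply is_derive_Reals in Hf.
  destruct (Rle_or_lt 0 (s * l)) as [H|H]; [exact H|exfalso].
  destruct (Hf (- (s * l))) as [del Hdel]; [lra|].
  pose proof (cond_pos del) as Hdp.
  set (h := Rmin d del / 2).
  assert (Hm : 0 < Rmin d del) by (apply Rmin_glb_lt; lra).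
  assert (H1 : Rmin d del <= d) by apply Rmin_l.
  assert (H2 : Rmin d del <= del) by apply Rmin_r.
  assert (Hh : 0 < h < d /\ h < del) by (unfold h; lra).
  specialize (Hmin h (proj1 Hh)).
  assert (Hsh : s * h <> 0) by (destruct Hs; subst s; lra).
  specialize (Hdel (s * h) Hsh).
  assert (Hab : Rabs (s * h) < del).
  { rewrite Rabs_mult, (Rabs_pos_eq h) by lra.
    destruct Hs; subst s; [rewrite Rabs_R1|rewrite Rabs_m1]; lra. }
  specialize (Hdel Hab). apply Rabs_def2 in Hdel.
  set (q := (f (x + s * h) - f x) / (s * h)) in *.
  assert (Hq : f (x + s * h) - f x = q * (s * h)) by (unfold q; field; split; intros E; apply Hsh; rewrite E; ring).
  assert (0 <= (q * s) * h) by lra.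
  assert (0 <= q * s) by (apply Rmult_le_reg_r with h; lra).
  destruct Hs; subst s; lra.
Qed.

(** Agreement on a nondegenerate interval forces equal derivatives up to its
    endpoints: there the difference vanishes on one side, which pins its
    derivative. *)
Lemma Derive_eq_on_interval (f g : R -> R) (a b x : R) :
  a < b -> a <= x <= b -> (forall t, a <= t <= b -> f t = g t) ->
  ex_derive f x -> ex_derive g x -> Derive f x = Derive g x.
Proof.
  intros Hab Hx Heq Hf Hg.
  assert (D : is_derive (fun t => f t - g t) x (Derive f x - Derive g x)).
  { apply (is_derive_minus f g); apply Derive_correct; assumption. }
  assert (D' : is_derive (fun t => g t - f t) x (Derive g x - Derive f x)).
  { apply (is_derive_minus g f); apply Derive_correct; assumption. }
  assert (Hs : exists s d, (s = 1 \/ s = -1) /\ 0 < d /\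
                 forall h, 0 < h < d -> a <= x + s * h <= b).
  { destruct (Rlt_or_le x b) as [H|H].
    - exists 1, (b - x). repeat split; try lra.
    - exists (-1), (x - a). repeat split; try lra. }
  destruct Hs as (s & d & Hs & Hd & Hin).
  assert (H1 : 0 <= s * (Derive f x - Derive g x)).
  { apply (derive_sign_at_one_sided_min _ x _ s d Hs D Hd).
    intros h Hh. rewrite !Heq by auto. lra. }
  assert (H2 : 0 <= s * (Derive g x - Derive f x)).
  { apply (derive_sign_at_one_sided_min _ x _ s d Hs D' Hd).
    intros h Hh. rewrite !Heq by auto. lra. }
  destruct Hs; subst s; lra.
Qed.

Lemma is_derive_lipschitz_bound (f : R -> R) (x l k : R) :
  (forall u, Rabs (f u - f x) <= k * Rabs (u - x)) -> is_derive f x l -> l <= k.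
Proof.
  intros Hlip Hf.
  assert (D : is_derive (fun u => k * u - f u) x (k - l)).
  { apply (is_derive_minus (fun u => k * u) f); [|exact Hf].
    auto_derive; trivial; ring. }
  enough (0 <= 1 * (k - l)) by lra.
  apply (derive_sign_at_one_sided_min _ x _ 1 1 (or_introl eq_refl) D); [lra|].
  intros h Hh. specialize (Hlip (x + 1 * h)).
  rewrite (Rabs_pos_eq (x + 1 * h - x)) in Hlip by lra.
  pose proof (Rle_abs (f (x + 1 * h) - f x)). lra.
Qed.

Lemma bounded_derive_lipschitz (f df : R -> R) (k : R) :
  (forall t, is_derive f t (df t)) -> (forall t, Rabs (df t) <= k) ->
  forall x y, Rabs (f y - f x) <= k * Rabs (y - x).
Proof.
  intros Hf Hdf x y. apply (bounded_variation f df). auto.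
Qed.

Lemma sinusoid_lipschitz (a b x y : R) :
  Rabs ((a * cos y + b * sin y) - (a * cos x + b * sin x))
    <= sqrt (a ^ 2 + b ^ 2) * Rabs (y - x).
Proof.
  apply (bounded_derive_lipschitz (fun t => a * cos t + b * sin t)
           (fun t => b * cos t - a * sin t)).
  - intros t. auto_derive; [exact I|ring].
  - intros t. rewrite <- sqrt_Rsqr_abs. apply sqrt_le_1_alt.
    pose proof (sin2_cos2 t) as H. unfold Rsqr in *.
    pose proof (pow2_ge_0 (a * cos t + b * sin t)). nra.
Qed.

Lemma cos_lipschitz (x y : R) : Rabs (cos y - cos x) <= Rabs (y - x).
Proof.
  pose proof (sinusoid_lipschitz 1 0 x y) as H.
  replace (1 ^ 2 + 0 ^ 2) with 1 in H by ring. rewrite sqrt_1 in H.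
  rewrite !Rmult_1_l, !Rmult_0_l, !Rplus_0_r in H. exact H.
Qed.

Lemma sin_lipschitz (x y : R) : Rabs (sin y - sin x) <= Rabs (y - x).
Proof.
  pose proof (sinusoid_lipschitz 0 1 x y) as H.
  replace (0 ^ 2 + 1 ^ 2) with 1 in H by ring. rewrite sqrt_1 in H.
  rewrite !Rmult_1_l, !Rmult_0_l, !Rplus_0_l in H. exact H.
Qed.

(** * Curves prescribed by their heading *)

Definition nonexpansive (th : R -> R) : Prop :=
  forall x y, Rabs (th y - th x) <= Rabs (y - x).

Definition heading_path (p : plane) (th : R -> R) (L : R) : path :=
  Path L (fun t => (fst p + RInt (fun u => cos (th u)) 0 t,
                    snd p + RInt (fun u => sin (th u)) 0 t)).

Lemma nonexpansive_continuous (f : R -> R) (x : R) : nonexpansive f -> continuous f x.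
Proof.
  intros Hf. apply filterlim_locally. intros eps. exists eps. intros y Hy.
  apply (Rle_lt_trans _ _ _ (Hf x y)). exact Hy.
Qed.

Section Heading.
Variables (p : plane) (th : R -> R) (L : R).
Hypothesis th_nonexp : nonexpansive th.
Let g := heading_path p th L.

Lemma cos_heading_continuous (x : R) : continuous (fun u => cos (th u)) x.
Proof.
  apply nonexpansive_continuous. intros y z.
  apply (Rle_trans _ _ _ (cos_lipschitz _ _)), th_nonexp.
Qed.

Lemma sin_heading_continuous (x : R) : continuous (fun u => sin (th u)) x.
Proof.
  apply nonexpansive_continuous. intros y z.
  apply (Rle_trans _ _ _ (sin_lipschitz _ _)), th_nonexp.
Qed.

Lemma is_derive_primitive (f : R -> R) (c x : R) :
  (forall y, continuous f y) -> is_derive (fun t => c + RInt f 0 t) x (f x).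
Proof.
  intros Hf.
  replace (f x) with (0 + f x) by ring.
  apply (is_derive_plus (fun _ => c) (fun t => RInt f 0 t)).
  - auto_derive; trivial.
  - apply (is_derive_RInt f (fun t => RInt f 0 t) 0 x); [|apply Hf].
    apply filter_forall. intros y. apply (RInt_correct (V := R_CompleteNormedModule) f).
    apply (ex_RInt_continuous (V := R_CompleteNormedModule)). auto.
Qed.

Lemma heading_path_derive_fst (t : R) : is_derive (fun u => fst (pt g u)) t (cos (th t)).
Proof. apply (is_derive_primitive (fun u => cos (th u))), cos_heading_continuous. Qed.

Lemma heading_path_derive_snd (t : R) : is_derive (fun u => snd (pt g u)) t (sin (th t)).
Proof. apply (is_derive_primitive (fun u => sin (th u))), sin_heading_continuous. Qed.

Lemma heading_path_vel (t : R) : vel g t = (cos (th t), sin (th t)).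
Proof.
  unfold vel. f_equal; apply is_derive_unique;
    [apply heading_path_derive_fst|apply heading_path_derive_snd].
Qed.

Lemma heading_path_diff (t : R) : diff_at g t.
Proof.
  split; eexists; [apply heading_path_derive_fst|apply heading_path_derive_snd].
Qed.

Lemma heading_path_start : pt g 0 = p.
Proof. simpl. rewrite !RInt_point. destruct p. unfold zero; simpl. f_equal; ring. Qed.

Lemma heading_path_twice_diff (t : R) : ex_derive th t -> twice_diff_at g t.
Proof.
  intros Hth. unfold twice_diff_at; simpl ex_derive_n. split.
  - apply (ex_derive_ext (fun u => cos (th u))).
    + intros u. symmetry. apply (f_equal fst (heading_path_vel u)).
    + auto_derive. exact Hth.
  - apply (ex_derive_ext (fun u => sin (th u))).
    + intros u. symmetry. apply (f_equal snd (heading_path_vel u)).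
    + auto_derive. exact Hth.
Qed.

(** The velocity moves on the unit circle no faster than the heading does, so
    testing the acceleration [A] against the direction of [A] itself gives
    [|A|^2 <= |A|].  This needs no formula for [A], hence also covers the
    points where the heading has a corner. *)
Lemma heading_path_curvature (t : R) : twice_diff_at g t -> pnorm (acc g t) <= 1.
Proof.
  unfold twice_diff_at; simpl ex_derive_n. intros [H1 H2].
  apply (ex_derive_ext _ (fun u => cos (th u))) in H1;
    [|intros u; apply (f_equal fst (heading_path_vel u))].
  apply (ex_derive_ext _ (fun u => sin (th u))) in H2;
    [|intros u; apply (f_equal snd (heading_path_vel u))].
  assert (E : acc g t = (Derive (fun u => cos (th u)) t, Derive (fun u => sin (th u)) t)).
  { unfold acc; simpl Derive_n. f_equal; apply Derive_ext; intros u;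
      [apply (f_equal fst (heading_path_vel u))|apply (f_equal snd (heading_path_vel u))]. }
  rewrite E. unfold pnorm; simpl fst; simpl snd.
  set (a := Derive (fun u => cos (th u)) t) in *.
  set (b := Derive (fun u => sin (th u)) t) in *.
  assert (D : is_derive (fun u => a * cos (th u) + b * sin (th u)) t (a * a + b * b)).
  { apply (is_derive_plus (fun u => a * cos (th u)) (fun u => b * sin (th u)));
      apply is_derive_scal; apply Derive_correct; assumption. }
  apply is_derive_lipschitz_bound with (k := sqrt (a ^ 2 + b ^ 2)) in D.
  - pose proof (sqrt_pos (a ^ 2 + b ^ 2)) as Hs.
    assert (Hq : sqrt (a ^ 2 + b ^ 2) * sqrt (a ^ 2 + b ^ 2) = a ^ 2 + b ^ 2)
      by (apply sqrt_sqrt; nra).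
    nra.
  - intros u. apply (Rle_trans _ _ _ (sinusoid_lipschitz a b (th t) (th u))).
    apply Rmult_le_compat_l; [apply sqrt_pos|apply th_nonexp].
Qed.

Lemma heading_path_admissible (P : dpoint) (s : plane) (l : list R) :
  p = pos P -> udir P = (cos (th 0), sin (th 0)) -> 0 < L -> pt g L = s ->
  (forall t, ~ In t l -> ex_derive th t) -> admissible_path P s g.
Proof.
  intros Hp Hu HL Hs Hl. repeat apply conj.
  - exact HL.
  - intros t _. repeat apply conj.
    + apply heading_path_diff.
    + apply heading_path_diff.
    + apply (continuous_ext (fun u => cos (th u))).
      * intros u. symmetry. apply (f_equal fst (heading_path_vel u)).
      * apply cos_heading_continuous.
    + apply (continuous_ext (fun u => sin (th u))).
      * intros u. symmetry. apply (f_equal snd (heading_path_vel u)).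
      * apply sin_heading_continuous.
    + rewrite heading_path_vel. unfold pnorm; simpl fst; simpl snd.
      rewrite Rplus_comm, <- !Rsqr_pow2, sin2_cos2. apply sqrt_1.
  - exists l. intros t _ Ht. apply heading_path_twice_diff; auto.
  - intros t _. apply heading_path_curvature.
  - rewrite heading_path_start. exact Hp.
  - rewrite heading_path_vel. symmetry. exact Hu.
  - exact Hs.
Qed.

Lemma heading_path_shift (F G : R -> R) (a b : R) :
  a <= b ->
  (forall t, a <= t <= b -> is_derive F t (cos (th t)) /\ is_derive G t (sin (th t))) ->
  pt g b = padd (pt g a) (F b - F a, G b - G a).
Proof.
  intros Hab HFG. unfold padd, g; simpl.
  assert (HI : forall f F : R -> R, (forall x, continuous f x) ->
            (forall t, a <= t <= b -> is_derive F t (f t)) ->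
            RInt f 0 b = RInt f 0 a + (F b - F a)).
  { clear - Hab. intros f F Hf HF.
    rewrite <- (RInt_Chasles f 0 a b) by (apply (ex_RInt_continuous (V := R_CompleteNormedModule)); auto).
    unfold plus; simpl. f_equal. apply is_RInt_unique.
    apply (is_RInt_derive F f).
    - rewrite Rmin_left, Rmax_right by lra. exact HF.
    - auto. }
  rewrite (HI (fun u => cos (th u)) F), (HI (fun u => sin (th u)) G).
  - f_equal; ring.
  - apply sin_heading_continuous.
  - intros t Ht. apply HFG, Ht.
  - apply cos_heading_continuous.
  - intros t Ht. apply HFG, Ht.
Qed.

Lemma heading_path_segment (eta a b : R) :
  a <= b -> (forall t, a <= t <= b -> th t = eta) ->
  pt g b = padd (pt g a) (pscal (b - a) (polar 1 eta)).
Proof.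
  intros Hab Hth.
  rewrite (heading_path_shift (fun t => t * cos eta) (fun t => t * sin eta) a b Hab).
  - unfold pscal, polar; simpl. f_equal. f_equal; ring.
  - intros t Ht. rewrite Hth by exact Ht. split; auto_derive; trivial; ring.
Qed.

Lemma heading_path_arc (eta k a b : R) :
  a <= b -> k * k = 1 -> (forall t, a <= t <= b -> th t = eta + k * (t - a)) ->
  pt g b = padd (pt g a) (k * (sin (eta + k * (b - a)) - sin eta),
                          k * (cos eta - cos (eta + k * (b - a)))).
Proof.
  intros Hab Hk Hth.
  rewrite (heading_path_shift (fun t => k * sin (eta + k * (t - a)))
             (fun t => - k * cos (eta + k * (t - a))) a b Hab).
  - rewrite Rminus_diag, Rmult_0_r, Rplus_0_r. f_equal. f_equal; ring.
  - intros t Ht. rewrite Hth by exact Ht.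
    split; auto_derive; trivial.
    + transitivity (k * k * cos (eta + k * (t + - a))); [ring|rewrite Hk; unfold Rminus; ring].
    + transitivity (k * k * sin (eta + k * (t + - a))); [ring|rewrite Hk; unfold Rminus; ring].
Qed.

End Heading.

(** * Deflecting the straight end of a path *)

Lemma ex_derive_near (f : R -> R) (x e : R) :
  ex_derive f x -> 0 < e -> locally x (fun t => Rabs (f t - f x) < e).
Proof.
  intros Hf He. apply ex_derive_continuous in Hf.
  exact (proj1 (filterlim_locally _ _) Hf (mkposreal e He)).
Qed.

(** A path that starts at the origin along the x-axis, turns left along the unit
    circle by the angle [psi t] and goes on straight for the length [lam t]
    reaches the target [(l + x * t, y * t)].  Pythagoras for the tangent from the
    target to the circle gives [lam]; the direction of the target seen from the
    centre [(0, 1)] lags behind the heading by [atan (1 / lam)], which gives [psi].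
    The terms [y / l] cancel in the total length, whose derivative is just [x]. *)
Lemma deflection_exists (l x y : R) :
  0 < l -> 0 <= y ->
  exists psi lam : R -> R,
    psi 0 = 0 /\ lam 0 = l /\ is_derive psi 0 (y / l) /\ is_derive lam 0 (x - y / l) /\
    at_right 0 (fun t => 0 <= psi t /\ 0 < lam t /\
      sin (psi t) + lam t * cos (psi t) = l + x * t /\
      1 - cos (psi t) + lam t * sin (psi t) = y * t).
Proof.
  intros Hl Hy.
  set (lam := fun t => sqrt ((l + x * t) ^ 2 + (y * t) ^ 2 - 2 * (y * t))).
  set (psi := fun t => atan ((y * t - 1) / (l + x * t)) + atan (1 / lam t)).
  assert (L0 : lam 0 = l).
  { unfold lam. rewrite <- (sqrt_pow2 l) at 2 by lra. f_equal. ring. }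
  assert (P0 : psi 0 = 0).
  { unfold psi. rewrite L0.
    replace ((y * 0 - 1) / (l + x * 0)) with (- (1 / l)) by (field; lra).
    rewrite atan_opp. ring. }
  assert (DL : is_derive lam 0 (x - y / l)).
  { unfold lam. auto_derive.
    - nra.
    - rewrite !Rmult_0_r, Rplus_0_r.
      replace (l * (l * 1) + 0 * (0 * 1) + - 0) with (l ^ 2) by ring.
      rewrite sqrt_pow2 by lra. field. lra. }
  assert (DP : is_derive psi 0 (y / l)).
  { unfold psi.
    replace (y / l) with ((y * l - (-1) * x) / (l * l + 1) + - (x - y / l) / (l * l + 1))
      by (field; split; nra).
    apply (is_derive_plus (fun t => atan ((y * t - 1) / (l + x * t)))
                          (fun t => atan (1 / lam t))).
    - auto_derive; [lra|]. field. split; nra.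
    - assert (Hex : ex_derive lam 0) by (eexists; exact DL).
      auto_derive; [rewrite L0; split; [exact Hex|lra]|].
      rewrite (is_derive_unique (fun t : R => lam t) 0 _ DL : Derive (fun t : R => lam t) 0 = _), L0. field. split; nra. }
  exists psi, lam. repeat (apply conj; [assumption|]).
  assert (EX : ex_derive (fun t => l + x * t) 0) by (auto_derive; trivial).
  assert (EY : ex_derive (fun t => y * t) 0) by (auto_derive; trivial).
  assert (EL : ex_derive lam 0) by (eexists; exact DL).
  pose proof (ex_derive_near _ _ l EX Hl) as NX.
  pose proof (ex_derive_near _ _ 1 EY Rlt_0_1) as NY.
  pose proof (ex_derive_near _ _ l EL Hl) as NL.
  generalize (filter_and _ _ NX (filter_and _ _ NY NL)).
  unfold at_right, within. apply filter_imp. intros t (HX & HY & HL) Ht.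
  rewrite L0 in HL. apply Rabs_def2 in HX, HY, HL.
  assert (Hy0 : 0 <= y * t) by (apply Rmult_le_pos; lra).
  assert (X0 : 0 < l + x * t) by lra.
  assert (lam0 : 0 < lam t) by lra.
  assert (Y1 : y * t < 1) by lra.
  assert (Hsq : lam t * lam t = (l + x * t) ^ 2 + (y * t) ^ 2 - 2 * (y * t)).
  { unfold lam. apply sqrt_sqrt.
    destruct (Rle_or_lt 0 ((l + x * t) ^ 2 + (y * t) ^ 2 - 2 * (y * t))) as [H|H]; [exact H|].
    unfold lam in lam0. rewrite sqrt_neg_0 in lam0; lra. }
  unfold psi. clearbody lam.
  generalize dependent (lam t). intros m _ Hm Hsq.
  generalize dependent (l + x * t). intros X _ X0 Hsq.
  generalize dependent (y * t). intros Y _ Y0 Y1 Hsq.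
  set (r := sqrt (X ^ 2 + (Y - 1) ^ 2)).
  assert (r0 : 0 < r) by (apply sqrt_lt_R0; nra).
  assert (rr : r * r = m * m + 1) by (unfold r; rewrite sqrt_sqrt; nra).
  assert (E1 : sqrt (1 + ((Y - 1) / X)²) = r / X).
  { rewrite <- (sqrt_Rsqr (r / X)) by (apply Rlt_le, Rdiv_lt_0_compat; lra).
    f_equal. unfold Rsqr. replace (r / X * (r / X)) with (r * r / (X * X)) by (field; lra).
    rewrite rr, Hsq. field. lra. }
  assert (E2 : sqrt (1 + (1 / m)²) = r / m).
  { rewrite <- (sqrt_Rsqr (r / m)) by (apply Rlt_le, Rdiv_lt_0_compat; lra).
    f_equal. unfold Rsqr. replace (r / m * (r / m)) with (r * r / (m * m)) by (field; lra).
    rewrite rr. field. lra. }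
  assert (EC : cos (atan ((Y - 1) / X) + atan (1 / m)) = (X * m - (Y - 1)) / (m * m + 1)).
  { rewrite cos_plus, !cos_atan, !sin_atan, E1, E2, <- rr. field. lra. }
  assert (ES : sin (atan ((Y - 1) / X) + atan (1 / m)) = ((Y - 1) * m + X) / (m * m + 1)).
  { rewrite sin_plus, !cos_atan, !sin_atan, E1, E2, <- rr. field. lra. }
  repeat apply conj.
  - (* Nonnegativity of [psi] reduces to [(1 - Y) * m <= X]. *)
    assert (H : atan ((1 - Y) / X) <= atan (1 / m)).
    { destruct (Rle_lt_or_eq_dec ((1 - Y) / X) (1 / m)) as [H|H].
      - apply Rmult_le_reg_r with (X * m); [apply Rmult_lt_0_compat; lra|].
        replace ((1 - Y) / X * (X * m)) with ((1 - Y) * m) by (field; lra).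
        replace (1 / m * (X * m)) with X by (field; lra).
        apply Rsqr_incr_0_var; [|lra]. unfold Rsqr.
        replace ((1 - Y) * m * ((1 - Y) * m)) with ((1 - Y) * (1 - Y) * (m * m)) by ring.
        rewrite Hsq.
        assert (0 <= Y * (2 - Y)) by (apply Rmult_le_pos; lra).
        assert (0 <= Y * (2 - Y) * (X ^ 2 + (1 - Y) ^ 2)) by (apply Rmult_le_pos; nra).
        lra.
      - apply Rlt_le, atan_increasing, H.
      - rewrite H. lra. }
    replace ((Y - 1) / X) with (- ((1 - Y) / X)) by (field; lra).
    rewrite atan_opp. lra.
  - exact Hm.
  - rewrite EC, ES. field. nra.
  - rewrite EC, ES.
    apply Rmult_eq_reg_r with (m * m + 1); [|nra].
    replace ((1 - (X * m - (Y - 1)) / (m * m + 1) + m * (((Y - 1) * m + X) / (m * m + 1))) * (m * m + 1))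
      with (Y * (m * m + 1)) by (field; nra). reflexivity.
Qed.

(** * Varying a branch *)

Lemma pdist_le (u v : plane) :
  pdist u v <= Rabs (fst u - fst v) + Rabs (snd u - snd v).
Proof.
  unfold pdist, pnorm, psub; simpl fst; simpl snd.
  set (a := fst u - fst v). set (b := snd u - snd v).
  pose proof (Rabs_pos a). pose proof (Rabs_pos b).
  rewrite <- (sqrt_Rsqr (Rabs a + Rabs b)) by lra.
  apply sqrt_le_1_alt.
  rewrite <- (pow2_abs a), <- (pow2_abs b). unfold Rsqr. nra.
Qed.

(** Comparing the curves at equal arc length costs [e] per unit of length; passing
    from [L * tau] to [L' * tau] costs the difference of the parameters, since
    positions and headings are both 1-Lipschitz. *)
Lemma heading_paths_close (p : plane) (th th' : R -> R) (L L' e tau : R) :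
  nonexpansive th -> nonexpansive th' -> 0 <= L ->
  (forall t, Rabs (th t - th' t) <= e) -> 0 <= tau <= 1 ->
  let g := heading_path p th L in
  let g' := heading_path p th' L' in
  pdist (pt g (L * tau)) (pt g' (L' * tau)) <= 2 * (L * e + Rabs (L - L')) /\
  pdist (vel g (L * tau)) (vel g' (L' * tau)) <= 2 * (e + Rabs (L - L')).
Proof.
  intros N N' HL He Ht g g'.
  assert (Hd : Rabs (L * tau - L' * tau) <= Rabs (L - L')).
  { replace (L * tau - L' * tau) with ((L - L') * tau) by ring.
    rewrite Rabs_mult, (Rabs_pos_eq tau) by lra.
    pose proof (Rabs_pos (L - L')). nra. }
  split.
  - assert (H : forall F F' f f' : R -> R, F 0 = F' 0 ->
       (forall t, is_derive F t (f t)) -> (forall t, is_derive F' t (f' t)) ->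
       (forall t, Rabs (f t - f' t) <= e) -> (forall t, Rabs (f' t) <= 1) ->
       Rabs (F (L * tau) - F' (L' * tau)) <= L * e + Rabs (L - L')).
    { clear - HL Hd He Ht. intros F F' f f' H0 DF DF' Hf Hf'.
      pose proof (bounded_derive_lipschitz (fun t => F t - F' t) (fun t => f t - f' t) e
        (fun t => is_derive_minus F F' t _ _ (DF t) (DF' t)) Hf 0 (L * tau)) as H1.
      pose proof (bounded_derive_lipschitz F' f' 1 DF' Hf' (L' * tau) (L * tau)) as H2.
      assert (0 <= L * tau <= L) by nra.
      rewrite Rminus_0_r, (Rabs_pos_eq (L * tau)) in H1 by lra.
      assert (0 <= e) by (apply (Rle_trans _ _ _ (Rabs_pos _) (Hf 0))).
      assert (e * (L * tau) <= L * e) by nra.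
      replace (F (L * tau) - F' (L' * tau)) with
        ((F (L * tau) - F' (L * tau) - (F 0 - F' 0)) + (F' (L * tau) - F' (L' * tau)))
        by (rewrite H0; ring).
      apply (Rle_trans _ _ _ (Rabs_triang _ _)). lra. }
    pose proof (heading_path_start p th L) as S.
    pose proof (heading_path_start p th' L') as S'.
    apply (Rle_trans _ _ _ (pdist_le _ _)).
    apply (Rle_trans _ ((L * e + Rabs (L - L')) + (L * e + Rabs (L - L')))); [|lra].
    apply Rplus_le_compat.
    + apply (H (fun t => fst (pt g t)) (fun t => fst (pt g' t))
               (fun t => cos (th t)) (fun t => cos (th' t))).
      * unfold g, g'. rewrite S, S'. reflexivity.
      * intros t. apply heading_path_derive_fst, N.
      * intros t. apply heading_path_derive_fst, N'.
      * intros t. apply (Rle_trans _ _ _ (cos_lipschitz _ _)), He.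
      * intros t. apply Rabs_le, COS_bound.
    + apply (H (fun t => snd (pt g t)) (fun t => snd (pt g' t))
               (fun t => sin (th t)) (fun t => sin (th' t))).
      * unfold g, g'. rewrite S, S'. reflexivity.
      * intros t. apply heading_path_derive_snd, N.
      * intros t. apply heading_path_derive_snd, N'.
      * intros t. apply (Rle_trans _ _ _ (sin_lipschitz _ _)), He.
      * intros t. apply Rabs_le, SIN_bound.
  - unfold g, g'. rewrite !heading_path_vel by assumption.
    assert (Ha : Rabs (th (L * tau) - th' (L' * tau)) <= e + Rabs (L - L')).
    { replace (th (L * tau) - th' (L' * tau)) with
        ((th (L * tau) - th' (L * tau)) + (th' (L * tau) - th' (L' * tau))) by ring.
      apply (Rle_trans _ _ _ (Rabs_triang _ _)), Rplus_le_compat; [apply He|].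
      apply (Rle_trans _ _ _ (N' _ _)), Hd. }
    apply (Rle_trans _ _ _ (pdist_le _ _)); simpl fst; simpl snd.
    pose proof (cos_lipschitz (th' (L' * tau)) (th (L * tau))).
    pose proof (sin_lipschitz (th' (L' * tau)) (th (L * tau))).
    lra.
Qed.

(** Heading of an arc of length [phi] on the side [s], then an arc of length
    [psi] on the side [k], then a segment. *)
Definition bent_heading (th0 s phi k psi t : R) : R :=
  th0 + s * Rmin t phi + k * Rmax 0 (Rmin (t - phi) psi).

Section BentHeading.
Variables th0 s phi k psi : R.
Hypothesis Hs : s = 1 \/ s = -1.
Hypothesis Hk : k = 1 \/ k = -1.
Hypothesis Hpsi : 0 <= psi.
Let th := bent_heading th0 s phi k psi.

Lemma bent_heading_first (t : R) : t <= phi -> th t = th0 + s * t.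
Proof.
  intros Ht. unfold th, bent_heading.
  rewrite (Rmin_left t) by lra. rewrite (Rmin_left (t - phi)) by lra.
  rewrite Rmax_left by lra. ring.
Qed.

Lemma bent_heading_second (t : R) :
  phi <= t <= phi + psi -> th t = th0 + s * phi + k * (t - phi).
Proof.
  intros Ht. unfold th, bent_heading.
  rewrite (Rmin_right t) by lra. rewrite (Rmin_left (t - phi)) by lra.
  rewrite Rmax_right by lra. ring.
Qed.

Lemma bent_heading_last (t : R) : phi + psi <= t -> th t = th0 + s * phi + k * psi.
Proof.
  intros Ht. unfold th, bent_heading.
  rewrite (Rmin_right t) by lra. rewrite (Rmin_right (t - phi)) by lra.
  rewrite Rmax_right by lra. ring.
Qed.

Lemma bent_heading_nonexpansive : nonexpansive th.
Proof.
  assert (W : forall x y, x <= y -> Rabs (th y - th x) <= y - x).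
  { intros x y Hxy.
    destruct (Rle_or_lt x phi) as [X|X]; [rewrite (bent_heading_first x) by lra|
      destruct (Rle_or_lt x (phi + psi)) as [X'|X'];
        [rewrite (bent_heading_second x) by lra|rewrite (bent_heading_last x) by lra]];
    (destruct (Rle_or_lt y phi) as [Y|Y]; [rewrite (bent_heading_first y) by lra|
      destruct (Rle_or_lt y (phi + psi)) as [Y'|Y'];
        [rewrite (bent_heading_second y) by lra|rewrite (bent_heading_last y) by lra]]);
    apply Rabs_le; destruct Hs as [E|E], Hk as [E'|E']; rewrite ?E, ?E'; lra. }
  intros x y. destruct (Rle_or_lt x y) as [H|H].
  - rewrite (Rabs_pos_eq (y - x)) by lra. apply W, H.
  - rewrite Rabs_minus_sym, (Rabs_minus_sym y), (Rabs_pos_eq (x - y)) by lra.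
    apply W. lra.
Qed.

Lemma bent_heading_ex_derive (t : R) :
  ~ In t (phi :: phi + psi :: nil) -> ex_derive th t.
Proof.
  intros Ht. simpl in Ht.
  assert (D : forall a b, ex_derive (fun u => a + b * u) t)
    by (intros; auto_derive; trivial).
  destruct (Rtotal_order t phi) as [H|[H|H]]; [|exfalso; auto|].
  - apply (ex_derive_ext_loc (fun u => th0 + s * u)); [|apply D].
    apply (filter_imp (fun u => u < phi)); [|apply (open_lt phi t H)].
    intros u Hu. rewrite bent_heading_first by lra. reflexivity.
  - destruct (Rtotal_order t (phi + psi)) as [H'|[H'|H']]; [|exfalso; auto|].
    + apply (ex_derive_ext_loc (fun u => (th0 + s * phi - k * phi) + k * u)); [|apply D].
      apply (filter_imp (fun u => u < phi + psi /\ phi < u)).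
      * intros u Hu. symmetry.
        transitivity (th0 + s * phi + k * (u - phi)); [|simpl; ring].
        apply bent_heading_second; lra.
      * apply filter_and; [apply (open_lt (phi + psi) t H')|apply (open_gt phi t H)].
    + apply (ex_derive_ext_loc (fun u => (th0 + s * phi + k * psi) + 0 * u)); [|apply D].
      apply (filter_imp (fun u => phi + psi < u)); [|apply (open_gt (phi + psi) t H')].
      intros u Hu. symmetry.
      transitivity (th0 + s * phi + k * psi); [|simpl; ring].
      apply bent_heading_last; lra.
Qed.

Lemma bent_heading_near (t : R) :
  Rabs (bent_heading th0 s phi k 0 t - bent_heading th0 s phi k psi t) <= psi.
Proof.
  unfold bent_heading.
  assert (H : Rmax 0 (Rmin (t - phi) 0) = 0) by (apply Rmax_left, Rmin_r).
  rewrite H.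
  assert (H1 : 0 <= Rmax 0 (Rmin (t - phi) psi)) by apply Rmax_l.
  assert (H2 : Rmax 0 (Rmin (t - phi) psi) <= psi) by (apply Rmax_lub; [lra|apply Rmin_r]).
  apply Rabs_le. destruct Hk as [E|E]; rewrite E; lra.
Qed.

(** Computed for all three pieces at once, so that [psi = 0] gives the end of an
    undeflected path. *)
Lemma bent_path_end (p : plane) (lam : R) :
  0 <= phi -> 0 <= lam ->
  pt (heading_path p th (phi + psi + lam)) (phi + psi + lam) =
  padd (padd p (s * (sin (th0 + s * phi) - sin th0), s * (cos th0 - cos (th0 + s * phi))))
    (padd (k * (sin (th0 + s * phi + k * psi) - sin (th0 + s * phi)),
           k * (cos (th0 + s * phi) - cos (th0 + s * phi + k * psi)))
      (pscal lam (polar 1 (th0 + s * phi + k * psi)))).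
Proof.
  intros Hphi Hlam. set (L := phi + psi + lam).
  pose proof bent_heading_nonexpansive as N.
  rewrite (heading_path_segment p th L N (th0 + s * phi + k * psi) (phi + psi) L);
    [|unfold L; lra|intros t Ht; apply bent_heading_last; lra].
  rewrite (heading_path_arc p th L N (th0 + s * phi) k phi (phi + psi));
    [|lra|destruct Hk as [E|E]; rewrite E; ring|intros t Ht; apply bent_heading_second; lra].
  rewrite (heading_path_arc p th L N th0 s 0 phi);
    [|lra|destruct Hs as [E|E]; rewrite E; ring
     |intros t Ht; rewrite bent_heading_first by lra; ring].
  rewrite heading_path_start.
  replace (phi + psi - phi) with psi by ring. replace (L - (phi + psi)) with lam by (unfold L; ring).
  rewrite Rminus_0_r. unfold padd; simpl. f_equal; ring.
Qed.

End BentHeading.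

Lemma polar_of_unit (x y : R) : x ^ 2 + y ^ 2 = 1 -> exists t, (x, y) = polar 1 t.
Proof.
  intros H. unfold polar.
  assert (Hx : -1 <= x <= 1) by nra.
  assert (Hs : sin (acos x) = Rabs y).
  { rewrite sin_acos, <- sqrt_Rsqr_abs by exact Hx. f_equal. unfold Rsqr. lra. }
  destruct (Rle_or_lt 0 y) as [Hy|Hy].
  - exists (acos x). rewrite cos_acos, Hs, Rabs_pos_eq by assumption. f_equal; ring.
  - exists (- acos x). rewrite cos_neg, sin_neg, cos_acos, Hs, Rabs_left by assumption.
    f_equal; ring.
Qed.

Lemma polar_of_plane (v : plane) : exists r t, 0 <= r /\ v = polar r t.
Proof.
  destruct v as [x y]. set (r := sqrt (x ^ 2 + y ^ 2)).
  assert (Hr : r * r = x ^ 2 + y ^ 2) by (apply sqrt_sqrt; nra).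
  destruct (Req_dec r 0) as [H|H].
  - exists 0, 0. split; [lra|]. unfold polar. rewrite H in Hr.
    rewrite !Rmult_0_l in *.
    f_equal; apply Rsqr_0_uniq; unfold Rsqr; nra.
  - destruct (polar_of_unit (x / r) (y / r)) as [t Ht].
    + replace ((x / r) ^ 2 + (y / r) ^ 2) with ((x ^ 2 + y ^ 2) / (r * r)) by (field; exact H).
      rewrite <- Hr. field. exact H.
    + exists r, t. split; [apply sqrt_pos|]. unfold polar in *.
      injection Ht as H1 H2. rewrite Rmult_1_l in H1, H2. rewrite <- H1, <- H2.
      f_equal; field; exact H.
Qed.

Lemma udir_polar (P : dpoint) : exists t, udir P = polar 1 t.
Proof.
  destruct P as [p v Hv]. unfold udir; simpl tan_vec.
  destruct (polar_of_plane v) as (r & t & Hr & E).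
  assert (Hn : pnorm v = r).
  { rewrite E. unfold pnorm, polar; simpl fst; simpl snd.
    pose proof (sin2_cos2 t) as H. unfold Rsqr in H.
    transitivity (sqrt (r ^ 2)); [f_equal|apply sqrt_pow2, Hr].
    transitivity (r ^ 2 * (sin t * sin t + cos t * cos t)); [ring|rewrite H; ring]. }
  exists t. rewrite Hn.
  assert (r <> 0) by (intros Z; apply Hv; rewrite E, Z; unfold polar; f_equal; ring).
  rewrite E. unfold pscal, polar; simpl. f_equal; field; assumption.
Qed.

Lemma sgn_cases (sd : side) : sgn sd = 1 \/ sgn sd = -1.
Proof. destruct sd; simpl; auto. Qed.

Lemma dubins_arc_polar (P : dpoint) (sd : side) (th0 t : R) :
  udir P = polar 1 th0 ->
  dubins_arc P sd t =
  padd (pos P) (sgn sd * (sin (th0 + sgn sd * t) - sin th0),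
                sgn sd * (cos th0 - cos (th0 + sgn sd * t))).
Proof.
  intros E. unfold dubins_arc, dubins_center. rewrite E.
  unfold rot, padd, psub, polar; simpl.
  rewrite sin_plus, cos_plus.
  destruct sd; simpl sgn.
  - rewrite !Rmult_1_l, cos_PI2, sin_PI2. f_equal; ring.
  - replace (-1 * (PI / 2)) with (- (PI / 2)) by ring.
    rewrite cos_neg, sin_neg, cos_PI2, sin_PI2. f_equal; ring.
Qed.

Lemma dubins_tangent_polar (P : dpoint) (sd : side) (th0 t : R) :
  udir P = polar 1 th0 -> dubins_tangent P sd t = polar 1 (th0 + sgn sd * t).
Proof.
  intros E. unfold dubins_tangent. rewrite E. unfold rot, polar; simpl.
  rewrite sin_plus, cos_plus. f_equal; ring.
Qed.

(** Stated for either side [k] of the empty second arc, so that the path can be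
    compared with a deflection to that side. *)
Lemma CS_path_heading (P : dpoint) (sd : side) (g : path) (th0 : R) :
  CS_path P sd g -> udir P = polar 1 th0 ->
  exists phi, 0 <= phi < len g /\ forall k, k = 1 \/ k = -1 ->
    forall t, 0 <= t <= len g ->
      pt g t = pt (heading_path (pos P) (bent_heading th0 (sgn sd) phi k 0) (len g)) t.
Proof.
  intros (phi & Hphi & Hlen & Harc & Hseg) E. exists phi. split; [lra|].
  intros k Hk t Ht.
  pose proof (sgn_cases sd) as Hs.
  assert (Hs2 : sgn sd * sgn sd = 1) by (destruct Hs as [H|H]; rewrite H; ring).
  set (th := bent_heading th0 (sgn sd) phi k 0).
  assert (N : nonexpansive th) by (apply bent_heading_nonexpansive; auto; lra).
  assert (A : forall u, 0 <= u <= phi ->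
            pt (heading_path (pos P) th (len g)) u = dubins_arc P sd u).
  { intros u Hu.
    rewrite (heading_path_arc _ th _ N th0 (sgn sd) 0 u); [|lra|exact Hs2|].
    - rewrite heading_path_start, Rminus_0_r. symmetry. apply dubins_arc_polar, E.
    - intros r Hr. unfold th. rewrite bent_heading_first by lra. ring. }
  destruct (Rle_or_lt t phi) as [H|H].
  - rewrite Harc by lra. symmetry. apply A. lra.
  - rewrite Hseg by lra.
    rewrite (heading_path_segment _ th _ N (th0 + sgn sd * phi) phi t); [|lra|].
    + rewrite A by lra. f_equal. f_equal. apply dubins_tangent_polar, E.
    + intros r Hr. unfold th. rewrite bent_heading_last by lra. ring.
Qed.

Lemma vel_eq_on_interval (g h : path) (a b t : R) :
  a < b -> a <= t <= b -> (forall u, a <= u <= b -> pt g u = pt h u) ->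
  diff_at g t -> diff_at h t -> vel g t = vel h t.
Proof.
  intros Hab Ht Heq [G1 G2] [H1 H2]. unfold vel. f_equal.
  - apply (Derive_eq_on_interval _ _ a b); auto.
    intros u Hu. simpl. f_equal. auto.
  - apply (Derive_eq_on_interval _ _ a b); auto.
    intros u Hu. simpl. f_equal. auto.
Qed.

Lemma locally_at_right (x : R) (Q : R -> Prop) : locally x Q -> at_right x Q.
Proof. unfold at_right, within. apply filter_imp. auto. Qed.

Lemma ex_derive_near_right (f : R -> R) (x e : R) :
  ex_derive f x -> 0 < e -> at_right x (fun t => Rabs (f t - f x) < e).
Proof. intros Hf He. apply locally_at_right, ex_derive_near; assumption. Qed.

Definition pdot (u v : plane) : R := fst u * fst v + snd u * snd v.

(** The segment is deflected at its start, towards the side on which [d] points.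
    The first arc is kept as it is.  To first order the length changes by the
    component of [d] along the arrival velocity, because a transverse
    displacement costs only a second-order amount. *)
Lemma branch_variation (P : dpoint) (sd : side) (s d : plane) (g : path) :
  CS_path P sd g -> admissible_path P s g ->
  exists h : R -> path,
    is_derive (fun t => len (h t)) 0 (pdot (vel g (len g)) d) /\ len (h 0) = len g /\
    forall eps, 0 < eps ->
      at_right 0 (fun t => admissible_path P (padd s (pscal t d)) (h t) /\
                           close_path eps g (h t)).
Proof.
  intros HCS Hadm. destruct Hadm as (HL & Hreg & _ & _ & _ & _ & Hend).
  destruct (udir_polar P) as [th0 Eu].
  destruct (CS_path_heading P sd g th0 HCS Eu) as (phi & Hphi & Hg).
  pose proof (sgn_cases sd) as Hsg. set (sg := sgn sd) in *.
  set (eta := th0 + sg * phi).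
  set (L := len g) in *. set (l := L - phi).
  set (x := cos eta * fst d + sin eta * snd d).
  set (y := cos eta * snd d - sin eta * fst d).
  assert (Hk : exists k, (k = 1 \/ k = -1) /\ 0 <= k * y).
  { destruct (Rle_or_lt 0 y); [exists 1|exists (-1)]; split; auto; lra. }
  destruct Hk as (k & Hk & Hky). specialize (Hg k Hk).
  assert (Hl : 0 < l) by (unfold l; lra).
  destruct (deflection_exists l x (k * y) Hl Hky)
    as (psi & lam & psi0 & lam0 & Dpsi & Dlam & Hdef).
  set (th := fun t => bent_heading th0 sg phi k (psi t)).
  set (h := fun t => heading_path (pos P) (th t) (phi + psi t + lam t)).
  set (th00 := bent_heading th0 sg phi k 0) in *.
  assert (N0 : nonexpansive th00) by (apply bent_heading_nonexpansive; auto; lra).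
  set (g0 := heading_path (pos P) th00 L) in *.
  assert (Hv : forall t, 0 <= t <= L -> vel g t = vel g0 t).
  { intros t Ht. apply (vel_eq_on_interval g g0 0 L); auto.
    - apply Hreg, Ht.
    - apply heading_path_diff, N0. }
  assert (Es : s = padd (padd (pos P) (sg * (sin eta - sin th0), sg * (cos th0 - cos eta)))
                        (pscal l (polar 1 eta))).
  { rewrite <- Hend, Hg by lra.
    pose proof (bent_path_end th0 sg phi k 0 Hsg Hk (Rle_refl 0) (pos P) l) as E.
    fold th00 in E. replace (phi + 0 + l) with L in E by (unfold l; ring).
    unfold g0. rewrite E by lra. fold eta.
    rewrite Rmult_0_r, Rplus_0_r, !Rminus_diag, Rmult_0_r.
    unfold padd; simpl. f_equal; ring. }
  exists h. split; [|split].
  - simpl len.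
    rewrite Hv by lra. unfold g0. rewrite heading_path_vel by exact N0.
    unfold th00. rewrite bent_heading_last by lra.
    replace (pdot _ d) with (0 + k * y / l + (x - k * y / l)).
    2:{ unfold pdot, x; simpl. fold eta. rewrite Rmult_0_r, Rplus_0_r. field. lra. }
    apply (is_derive_plus (fun t => phi + psi t) lam); [|exact Dlam].
    apply (is_derive_plus (fun _ => phi) psi); [|exact Dpsi].
    auto_derive; trivial.
  - simpl. rewrite psi0, lam0. unfold l. ring.
  - intros eps Heps.
    set (e := eps / (8 * (1 + L))).
    assert (He : 0 < e) by (apply Rdiv_lt_0_compat; lra).
    assert (Hee : e * (8 * (1 + L)) = eps) by (unfold e; field; lra).
    assert (EP : ex_derive psi 0) by (eexists; exact Dpsi).
    assert (EL : ex_derive lam 0) by (eexists; exact Dlam).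
    pose proof (ex_derive_near_right _ _ e EP He) as NP.
    pose proof (ex_derive_near_right _ _ e EL He) as NL.
    generalize (filter_and _ _ Hdef (filter_and _ _ NP NL)).
    apply filter_imp.
    intros t ((Hpsi & Hlam & E1 & E2) & HP & HLm).
    rewrite psi0, Rminus_0_r, Rabs_pos_eq in HP by exact Hpsi.
    rewrite lam0 in HLm.
    assert (Nt : nonexpansive (th t)) by (apply bent_heading_nonexpansive; auto).
    split.
    + apply (heading_path_admissible _ _ _ Nt P _ (phi :: phi + psi t :: nil)); auto.
      * unfold th. rewrite bent_heading_first by lra.
        rewrite Rmult_0_r, Rplus_0_r, Eu. unfold polar. f_equal; ring.
      * lra.
      * unfold th. rewrite bent_path_end by (auto; lra). fold eta. rewrite Es.
        (* The deflection was solved for a left turn; [k * k = 1] and the parity of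
           [cos] and [sin] carry the solution over to the side [k]. *)
        assert (K2 : k * k = 1) by (destruct Hk as [E|E]; rewrite E; ring).
        assert (C1 : cos (k * psi t) = cos (psi t)).
        { destruct Hk as [E|E]; rewrite E; [rewrite Rmult_1_l; reflexivity|].
          replace (-1 * psi t) with (- psi t) by ring. apply cos_neg. }
        assert (S1 : sin (k * psi t) = k * sin (psi t)).
        { destruct Hk as [E|E]; rewrite E; [rewrite !Rmult_1_l; reflexivity|].
          replace (-1 * psi t) with (- psi t) by ring. rewrite sin_neg. ring. }
        unfold padd, pscal, polar; simpl fst; simpl snd.
        rewrite !sin_plus, !cos_plus, C1, S1.
        assert (U : cos eta * cos eta + sin eta * sin eta = 1).
        { pose proof (sin2_cos2 eta) as H. unfold Rsqr in H. lra. }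
        assert (X : fst d = x * cos eta - y * sin eta).
        { unfold x, y. transitivity (fst d * (cos eta * cos eta + sin eta * sin eta));
            [rewrite U; ring|ring]. }
        assert (Y : snd d = x * sin eta + y * cos eta).
        { unfold x, y. transitivity (snd d * (cos eta * cos eta + sin eta * sin eta));
            [rewrite U; ring|ring]. }
        assert (E3 : k * (1 - cos (psi t) + lam t * sin (psi t)) = y * t).
        { rewrite E2. transitivity (k * k * (y * t)); [ring|rewrite K2; ring]. }
        rewrite X, Y.
        f_equal.
        -- transitivity (fst (pos P) + sg * (sin eta - sin th0)
             + (k * k * sin (psi t) + lam t * cos (psi t)) * cos eta
             - (k * (1 - cos (psi t) + lam t * sin (psi t))) * sin eta); [ring|].
           rewrite K2, E3. replace (1 * sin (psi t) + lam t * cos (psi t)) with (l + x * t)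
             by (rewrite <- E1; ring). ring.
        -- transitivity (snd (pos P) + sg * (cos th0 - cos eta)
             + (k * k * sin (psi t) + lam t * cos (psi t)) * sin eta
             + (k * (1 - cos (psi t) + lam t * sin (psi t))) * cos eta); [ring|].
           rewrite K2, E3. replace (1 * sin (psi t) + lam t * cos (psi t)) with (l + x * t)
             by (rewrite <- E1; ring). ring.
      * intros u Hu. apply bent_heading_ex_derive; auto.
    + intros tau Htau. change (len g) with L. simpl len.
      assert (H01 : 0 <= L * tau <= L) by nra.
      rewrite (Hg _ H01), (Hv _ H01).
      assert (HLL : Rabs (L - (phi + psi t + lam t)) < 2 * e).
      { apply Rabs_def2 in HLm. apply Rabs_def1; unfold l in HLm; lra. }
      destruct (heading_paths_close (pos P) th00 (th t) L (phi + psi t + lam t) e tau N0 Nt)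
        as [H1 H2]; [lra| |exact Htau|].
      { intros u. apply (Rle_trans _ (psi t)); [apply bent_heading_near; auto|lra]. }
      split; [apply (Rle_lt_trans _ _ _ H1)|apply (Rle_lt_trans _ _ _ H2)]; nra.
Qed.

Definition edge_resultant (w : index -> R) (N : network) : plane :=
  padd (pscal (w I1) (edge_dir N I1))
    (padd (pscal (w I2) (edge_dir N I2)) (pscal (w I3) (edge_dir N I3))).

Lemma at_right_ne (s d q : plane) : s <> q -> at_right 0 (fun t => padd s (pscal t d) <> q).
Proof.
  intros Hne.
  assert (H : forall a b c, a <> c -> at_right 0 (fun t => a + t * b <> c)).
  { intros a b c Hac.
    assert (D : ex_derive (fun t => a + t * b) 0) by (auto_derive; trivial).
    assert (Hp : 0 < Rabs (a - c)) by (apply Rabs_pos_lt; lra).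
    generalize (ex_derive_near_right _ _ _ D Hp).
    apply filter_imp. intros t Ht E. rewrite E in Ht.
    replace (c - (a + 0 * b)) with (- (a - c)) in Ht by ring.
    rewrite Rabs_Ropp in Ht. lra. }
  destruct s as [a1 a2], q as [c1 c2], d as [b1 b2].
  destruct (Req_dec a1 c1) as [E1|E1].
  - assert (E2 : a2 <> c2) by (intros E2; apply Hne; rewrite E1, E2; reflexivity).
    generalize (H a2 b2 c2 E2). apply filter_imp. unfold padd, pscal; simpl. congruence.
  - generalize (H a1 b1 c1 E1). apply filter_imp. unfold padd, pscal; simpl. congruence.
Qed.

(** Displacing the Steiner point along the resultant [r] changes the weighted
    length at the rate [- |r| ^ 2], which minimality forbids unless [r = 0]. *)
Lemma full_dubins_equilibrium (w : index -> R) (P : index -> dpoint) (N : network) :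
  full_dubins_network w P N -> edge_resultant w N = (0, 0).
Proof.
  intros [[[Hne Hadm] (eps & Heps & Hmin)] HCS].
  set (r := edge_resultant w N). set (s := steiner N) in *.
  assert (V : forall i, exists h : R -> path,
    is_derive (fun t => len (h t)) 0 (pdot (vel (branch N i) (len (branch N i))) r) /\
    len (h 0) = len (branch N i) /\
    at_right 0 (fun t => admissible_path (P i) (padd s (pscal t r)) (h t) /\
                         close_path eps (branch N i) (h t))).
  { intros i. destruct (HCS i) as [sd Hsd].
    destruct (branch_variation (P i) sd s r (branch N i) Hsd (Hadm i)) as (h & H1 & H2 & H3).
    exists h. auto. }
  destruct (V I1) as (h1 & D1 & L1 & A1). destruct (V I2) as (h2 & D2 & L2 & A2).
  destruct (V I3) as (h3 & D3 & L3 & A3). clear V.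
  set (M := fun t => Network (padd s (pscal t r)) (triple (h1 t) (h2 t) (h3 t))).
  assert (DW : is_derive (fun t => weighted_length w (M t)) 0 (- pdot r r)).
  { unfold weighted_length; simpl.
    replace (- pdot r r) with
      (w I1 * pdot (vel (branch N I1) (len (branch N I1))) r
       + w I2 * pdot (vel (branch N I2) (len (branch N I2))) r
       + w I3 * pdot (vel (branch N I3) (len (branch N I3))) r).
    2:{ unfold r at 4. unfold edge_resultant, edge_dir, pdot, padd, pscal; simpl. ring. }
    apply (is_derive_plus (fun t => w I1 * len (h1 t) + w I2 * len (h2 t))
                          (fun t => w I3 * len (h3 t)));
      [apply (is_derive_plus (fun t => w I1 * len (h1 t)) (fun t => w I2 * len (h2 t)))|];
      apply is_derive_scal; assumption. }
  assert (Hs : at_right 0 (fun t => pdist s (padd s (pscal t r)) < eps)).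
  { assert (Hc : at_right 0 (fun t => t < eps / (1 + pnorm r))).
    { pose proof (sqrt_pos (fst r ^ 2 + snd r ^ 2)) as Hp. fold (pnorm r) in Hp.
      apply locally_at_right. apply (open_lt (eps / (1 + pnorm r)) 0).
      apply Rdiv_lt_0_compat; lra. }
    assert (H0 : at_right 0 (fun t => 0 < t))
      by (exists (mkposreal 1 Rlt_0_1); auto).
    generalize (filter_and _ _ H0 Hc). apply filter_imp. intros t [Ht1 Ht2].
    pose proof (sqrt_pos (fst r ^ 2 + snd r ^ 2)) as Hp. fold (pnorm r) in Hp.
    assert (E : pdist s (padd s (pscal t r)) = t * pnorm r).
    { unfold pdist, pnorm.
      transitivity (sqrt (t ^ 2) * sqrt (fst r ^ 2 + snd r ^ 2));
        [|rewrite sqrt_pow2 by lra; reflexivity].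
      rewrite <- sqrt_mult by nra. f_equal. unfold psub, padd, pscal; simpl. ring. }
    rewrite E. apply Rmult_lt_compat_r with (r := 1 + pnorm r) in Ht2; [|lra].
    unfold Rdiv in Ht2. rewrite Rmult_assoc, Rinv_l in Ht2 by lra. nra. }
  assert (Hall : at_right 0 (fun t => weighted_length w N <= weighted_length w (M t))).
  { generalize (filter_and _ _ (filter_and _ _ A1 (filter_and _ _ A2 A3))
      (filter_and _ _ Hs (filter_and _ _ (at_right_ne s r _ (Hne I1))
         (filter_and _ _ (at_right_ne s r _ (Hne I2)) (at_right_ne s r _ (Hne I3)))))).
    apply filter_imp.
    intros t (([B1 C1] & [B2 C2] & [B3 C3]) & Hst & N1 & N2 & N3).
    apply Hmin.
    - split; intros [| |]; assumption.
    - split; [exact Hst|]. intros [| |]; assumption. }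
  destruct Hall as [del Hdel].
  assert (Hpos : 0 <= 1 * - pdot r r).
  { apply (derive_sign_at_one_sided_min _ 0 _ 1 del (or_introl eq_refl) DW (cond_pos del)).
    intros t Ht. replace (weighted_length w (M 0)) with (weighted_length w N)
      by (unfold weighted_length; simpl; rewrite L1, L2, L3; reflexivity).
    apply Hdel; [|lra].
    change (Rabs (0 + 1 * t - 0) < del). rewrite Rabs_pos_eq; lra. }
  destruct r as [a b]. unfold pdot in Hpos; simpl in Hpos.
  f_equal; apply Rsqr_0_uniq; unfold Rsqr; nra.
Qed.

(** * Angles at the Steiner point *)

(** The cyclic order excludes a reflex angle: if the second direction were at an
    angle at least [PI] from the first, so would be the third, and nothing could
    balance them transversally to the first edge.  The cosine rule in the triangle
    with sides [w I1], [w I2], [w I3] then gives the angle. *)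
Lemma fermat_angle (w : index -> R) (t1 t2 t3 : R) :
  (forall i, 0 < w i) -> t1 < t2 < t3 -> t3 < t1 + 2 * PI ->
  w I1 * cos t1 + (w I2 * cos t2 + w I3 * cos t3) = 0 ->
  w I1 * sin t1 + (w I2 * sin t2 + w I3 * sin t3) = 0 ->
  t2 - t1 = alpha w.
Proof.
  intros hw H12 H31 EC ES.
  pose proof (hw I1) as W1. pose proof (hw I2) as W2. pose proof (hw I3) as W3.
  (* Measure all directions from the first edge. *)
  replace t2 with (t1 + (t2 - t1)) in EC, ES by ring.
  replace t3 with (t1 + (t3 - t1)) in EC, ES by ring.
  set (b := t2 - t1) in *. set (c := t3 - t1) in *.
  assert (Hb : 0 < b < c /\ c < 2 * PI) by (unfold b, c; lra).
  rewrite !sin_plus, !cos_plus in *.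
  pose proof (sin2_cos2 t1) as U. unfold Rsqr in U.
  assert (X : w I1 + w I2 * cos b + w I3 * cos c = 0).
  { transitivity ((sin t1 * sin t1 + cos t1 * cos t1) * (w I1 + w I2 * cos b + w I3 * cos c));
      [rewrite U; ring|].
    transitivity (cos t1 * 0 + sin t1 * 0); [rewrite <- EC at 1; rewrite <- ES; ring|ring]. }
  assert (Y : w I2 * sin b + w I3 * sin c = 0).
  { transitivity ((sin t1 * sin t1 + cos t1 * cos t1) * (w I2 * sin b + w I3 * sin c));
      [rewrite U; ring|].
    transitivity (cos t1 * 0 - sin t1 * 0); [rewrite <- ES at 1; rewrite <- EC; ring|ring]. }
  assert (Hpi : b < PI).
  { destruct (Rlt_or_le b PI) as [H|H]; [exact H|exfalso].
    assert (sin c < 0) by (apply sin_lt_0; lra).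
    assert (sin b <= 0) by (apply sin_le_0; lra).
    nra. }
  assert (Hc : (w I1 ^ 2 + w I2 ^ 2 - w I3 ^ 2) / (2 * w I1 * w I2) = - cos b).
  { pose proof (sin2_cos2 b) as Ub. pose proof (sin2_cos2 c) as Uc. unfold Rsqr in *.
    assert (E3 : w I3 ^ 2 = (w I1 + w I2 * cos b) ^ 2 + (w I2 * sin b) ^ 2).
    { replace (w I1 + w I2 * cos b) with (- (w I3 * cos c)) by lra.
      replace (w I2 * sin b) with (- (w I3 * sin c)) by lra.
      transitivity (w I3 ^ 2 * (sin c * sin c + cos c * cos c)); [rewrite Uc; ring|ring]. }
    assert (E4 : w I3 ^ 2 = w I1 ^ 2 + w I2 ^ 2 + 2 * w I1 * w I2 * cos b).
    { rewrite E3.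
      transitivity (w I1 ^ 2 + w I2 ^ 2 * (sin b * sin b + cos b * cos b)
                    + 2 * w I1 * w I2 * cos b); [ring|rewrite Ub; ring]. }
    rewrite E4. field. lra. }
  unfold alpha. rewrite Hc, acos_opp, acos_cos by lra. ring.
Qed.

Definition turn (o : cyclic_order) : R :=
  match o with Order123 => 1 | Order132 => -1 end.

Lemma polar_period (r t : R) : polar r (t + 2 * PI) = polar r t.
Proof.
  unfold polar. rewrite cos_plus, sin_plus, cos_2PI, sin_2PI. f_equal; ring.
Qed.

Lemma edge_angle (w : index -> R) (o : cyclic_order) (N : network) :
  (forall i, 0 < w i) -> edge_resultant w N = (0, 0) -> has_cyclic_order o N ->
  exists t, edge_dir N I1 = polar 1 t /\ edge_dir N I2 = polar 1 (t + turn o * alpha w).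
Proof.
  intros hw Hr Ho. destruct o; simpl in Ho;
    destruct Ho as (t1 & t2 & t3 & H12 & H31 & U1 & U2 & U3);
    unfold edge_resultant in Hr; rewrite U1, U2, U3 in Hr;
    unfold polar, padd, pscal in Hr; simpl in Hr; injection Hr as EC ES;
    exists t1; split; try exact U1; simpl turn.
  - rewrite U2. f_equal.
    rewrite <- (fermat_angle w t1 t2 t3 hw); [ring|lra|lra|lra|lra].
  - (* Reflect in the x-axis to recover the counterclockwise order. *)
    assert (E : (2 * PI - t3) - (- t1) = alpha w).
    { assert (P : forall t, cos (2 * PI - t) = cos t /\ sin (2 * PI - t) = - sin t).
      { intros t. rewrite cos_minus, sin_minus, cos_2PI, sin_2PI. split; ring. }
      destruct (P t2) as [C2 S2]. destruct (P t3) as [C3 S3].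
      apply (fermat_angle w (- t1) (2 * PI - t3) (2 * PI - t2) hw);
        rewrite ?C2, ?C3, ?S2, ?S3, ?cos_neg, ?sin_neg; lra. }
    rewrite U3, <- E. rewrite <- (polar_period 1 (t1 + _)). f_equal. ring.
Qed.

(** * Tangency to the Dubins circles *)

Definition pcross (u v : plane) : R := fst u * snd v - snd u * fst v.

(** The signed distance from the Dubins centre to the oriented line of the
    segment: the tangent line of an oriented circle stays at distance 1, on the
    side determined by the orientation. *)
Lemma CS_path_tangency (P : dpoint) (sd : side) (s : plane) (g : path) :
  CS_path P sd g -> admissible_path P s g ->
  pcross (vel g (len g)) (psub s (dubins_center P sd)) = - sgn sd.
Proof.
  intros (phi & Hphi & Hlen & _ & Hseg) (HL & Hreg & _ & _ & _ & _ & Hend).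
  destruct (udir_polar P) as [th0 Eu].
  pose proof (dubins_arc_polar P sd th0 phi Eu) as EA.
  rewrite (dubins_tangent_polar P sd th0 phi Eu) in Hseg.
  set (eta := th0 + sgn sd * phi) in *.
  set (h := Path (len g) (fun t => padd (dubins_arc P sd phi) (pscal (t - phi) (polar 1 eta)))).
  assert (Dh : forall t, is_derive (fun u => fst (pt h u)) t (cos eta) /\
                         is_derive (fun u => snd (pt h u)) t (sin eta)).
  { intros t. simpl. split; auto_derive; trivial; ring. }
  assert (Hv : vel g (len g) = polar 1 eta).
  { transitivity (vel h (len g)).
    - apply (vel_eq_on_interval g h phi (len g)); [lra|lra|exact Hseg| |].
      + apply Hreg. lra.
      + split; eexists; apply Dh.
    - unfold vel, polar. rewrite !Rmult_1_l.
      f_equal; apply is_derive_unique, Dh. }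
  rewrite Hv, <- Hend, Hseg by lra. rewrite EA.
  unfold dubins_center. rewrite Eu.
  pose proof (sin2_cos2 eta) as U. unfold Rsqr in U.
  assert (R : rot (sgn sd * (PI / 2)) (polar 1 th0)
              = (- sgn sd * sin th0, sgn sd * cos th0)).
  { unfold rot, polar; simpl. destruct sd; simpl sgn.
    - rewrite !Rmult_1_l, cos_PI2, sin_PI2. f_equal; ring.
    - replace (-1 * (PI / 2)) with (- (PI / 2)) by ring.
      rewrite cos_neg, sin_neg, cos_PI2, sin_PI2. f_equal; ring. }
  rewrite R. unfold pcross, psub, padd, pscal, polar; simpl fst; simpl snd.
  transitivity (- sgn sd * (sin eta * sin eta + cos eta * cos eta)); [ring|rewrite U; ring].
Qed.

(** * Limacons *)

Lemma rot_polar (a r t : R) : rot a (polar r t) = polar r (a + t).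
Proof. unfold rot, polar; simpl. rewrite cos_plus, sin_plus. f_equal; ring. Qed.

(** Writing [U] and [V] as multiples of unit vectors, the polar angle is
    [th = eta + tB - psi]; the terms turning twice as fast match for [psi = 2 * tB - tA],
    and the pole is moved by the constant part of [2 A cos th e^(i (th + psi))]. *)
Lemma limacon_of_rotations (O U V : plane) :
  V <> (0, 0) ->
  limacon (fun q => exists eta, q = padd O (padd (rot (2 * eta) U) (rot eta V))).
Proof.
  intros HV.
  destruct (polar_of_plane U) as (A & tA & _ & EU).
  destruct (polar_of_plane V) as (B & tB & _ & EV).
  assert (HB : B <> 0).
  { intros E. apply HV. rewrite EV, E. unfold polar. f_equal; ring. }
  set (psi := 2 * tB - tA).
  exists (psub O (polar A psi)), psi, (2 * A), B. split; [exact HB|].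
  assert (Key : forall th,
    padd (psub O (polar A psi)) (polar (B + 2 * A * cos th) (th + psi)) =
    padd O (padd (polar A (th + (th + psi))) (polar B (th + psi)))).
  { intros th. unfold padd, psub, polar; simpl.
    rewrite (cos_plus th (th + psi)), (sin_plus th (th + psi)).
    assert (C : cos psi = cos th * cos (th + psi) + sin th * sin (th + psi)).
    { rewrite <- cos_minus, <- cos_neg. f_equal. ring. }
    assert (S : sin psi = cos th * sin (th + psi) - sin th * cos (th + psi)).
    { transitivity (sin ((th + psi) - th)); [f_equal; ring|rewrite sin_minus; ring]. }
    rewrite C, S. f_equal; ring. }
  intros q. rewrite EU, EV. split.
  - intros [eta E]. exists (eta + tB - psi). rewrite Key, E, !rot_polar.
    f_equal. f_equal; f_equal; unfold psi; ring.
  - intros [th E]. exists (th + psi - tB). rewrite E, Key, !rot_polar.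
    f_equal. f_equal; f_equal; unfold psi; ring.
Qed.

(** With [v1], [v2] the directions of the lines, Cramer's rule reads
    [sin beta * q = (v1 x q) v2 - (v2 x q) v1], and the equations give
    [vi x q = vi x ci - si].  Products of two trigonometric functions of [eta]
    split into a constant part [O] and a part [U] turning at double speed; the
    terms [si] form [V], nonzero because [v1] and [v2] are independent. *)
Lemma tangent_lines_meet_on_limacon (c1 c2 : plane) (s1 s2 beta : R) :
  s1 <> 0 -> sin beta <> 0 ->
  exists K : plane -> Prop, limacon K /\ forall q eta,
    pcross (polar 1 eta) (psub q c1) = - s1 ->
    pcross (polar 1 (eta + beta)) (psub q c2) = - s2 -> K q.
Proof.
  intros Hs Hb. destruct c1 as [x1 y1], c2 as [x2 y2].
  set (O := pscal (/ (2 * sin beta))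
    (psub (rot (beta - PI / 2) (x1, y1)) (rot (- beta - PI / 2) (x2, y2)))).
  set (U := pscal (/ (2 * sin beta)) (rot beta (y1 - y2, x1 - x2))).
  set (V := pscal (/ sin beta) (psub (s2, 0) (polar s1 beta))).
  exists (fun q => exists eta, q = padd O (padd (rot (2 * eta) U) (rot eta V))).
  split.
  { apply limacon_of_rotations.
    (* The second coordinate of [V] is [- s1]. *)
    unfold V, pscal, psub, polar; simpl.
    intros E. apply (f_equal snd) in E. simpl in E.
    replace (/ sin beta * (0 - s1 * sin beta)) with (- s1) in E by (field; exact Hb). lra. }
  intros [x y] eta E1 E2. exists eta.
  unfold pcross, psub, polar in E1, E2; simpl in E1, E2.
  rewrite cos_plus, sin_plus in E2.
  unfold O, U, V, padd, pscal, psub, rot, polar; simpl.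
  rewrite !sin_minus, !cos_minus, !sin_neg, !cos_neg, cos_PI2, sin_PI2, cos_2a, sin_2a.
  pose proof (sin2_cos2 eta) as P. unfold Rsqr in P.
  set (C := cos eta) in *. set (S := sin eta) in *.
  set (Cb := cos beta) in *. set (Sb := sin beta) in *.
  assert (F1 : C * y1 - S * x1 - s1 = C * y - S * x) by lra.
  assert (F2 : (C * Cb - S * Sb) * y2 - (S * Cb + C * Sb) * x2 - s2
               = (C * Cb - S * Sb) * y - (S * Cb + C * Sb) * x) by lra.
  assert (X : x * Sb * (S * S + C * C) =
     (C * Cb - S * Sb) * (C * y1 - S * x1 - s1)
     - C * ((C * Cb - S * Sb) * y2 - (S * Cb + C * Sb) * x2 - s2)).
  { rewrite F1, F2. ring. }
  assert (Y : y * Sb * (S * S + C * C) =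
     (S * Cb + C * Sb) * (C * y1 - S * x1 - s1)
     - S * ((C * Cb - S * Sb) * y2 - (S * Cb + C * Sb) * x2 - s2)).
  { rewrite F1, F2. ring. }
  rewrite P, Rmult_1_r in X, Y. clear F1 F2 E1 E2.
  f_equal; apply Rmult_eq_reg_r with Sb; try exact Hb.
  - rewrite X.
    transitivity (((Sb * x1 + Cb * y1 + Sb * x2 - Cb * y2) * (S * S + C * C)
      + (C * C - S * S) * (Cb * (y1 - y2) - Sb * (x1 - x2))
      - 2 * S * C * (Sb * (y1 - y2) + Cb * (x1 - x2))) / 2
      + C * (s2 - s1 * Cb) + S * (s1 * Sb)); [field|rewrite P; field; exact Hb].
  - rewrite Y.
    transitivity (((- Cb * x1 + Sb * y1 + Cb * x2 + Sb * y2) * (S * S + C * C)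
      + 2 * S * C * (Cb * (y1 - y2) - Sb * (x1 - x2))
      + (C * C - S * S) * (Sb * (y1 - y2) + Cb * (x1 - x2))) / 2
      + S * (s2 - s1 * Cb) - C * (s1 * Sb)); [field|rewrite P; field; exact Hb].
Qed.

Theorem theorem1 (w : index -> R) (hw : forall i, 0 < w i)
  (halpha : 0 < alpha w < PI)
  (p1 p2 : dpoint) (sd1 sd2 : side) (o : cyclic_order) :
  exists K : plane -> Prop, limacon K /\
    forall (p3 : dpoint) (N : network),
      full_dubins_network w (triple p1 p2 p3) N ->
      CS_path p1 sd1 (branch N I1) ->
      CS_path p2 sd2 (branch N I2) ->
      has_cyclic_order o N ->
      K (steiner N).
Proof.
  assert (Hsin : sin (turn o * alpha w) <> 0).
  { pose proof (sin_gt_0 _ (proj1 halpha) (proj2 halpha)).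
    destruct o; simpl turn; [rewrite Rmult_1_l; lra|].
    replace (-1 * alpha w) with (- alpha w) by ring. rewrite sin_neg. lra. }
  assert (Hsg : sgn sd1 <> 0) by (destruct (sgn_cases sd1); lra).
  destruct (tangent_lines_meet_on_limacon (dubins_center p1 sd1) (dubins_center p2 sd2)
              (sgn sd1) (sgn sd2) (turn o * alpha w) Hsg Hsin) as (K & HK & Hmeet).
  exists K. split; [exact HK|].
  intros p3 N HN H1 H2 Ho.
  pose proof (full_dubins_equilibrium _ _ _ HN) as Heq.
  destruct HN as [[[_ Hadm] _] _].
  destruct (edge_angle w o N hw Heq Ho) as (t & E1 & E2).
  pose proof (CS_path_tangency p1 sd1 _ _ H1 (Hadm I1)) as T1.
  pose proof (CS_path_tangency p2 sd2 _ _ H2 (Hadm I2)) as T2.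
  (* The edge directions point away from the Steiner point, the velocities into it. *)
  assert (Opp : forall i a, edge_dir N i = polar 1 a ->
            vel (branch N i) (len (branch N i)) = polar 1 (a + PI)).
  { intros i a E. unfold edge_dir in E. unfold polar in *.
    rewrite neg_cos, neg_sin.
    destruct (vel (branch N i) (len (branch N i))) as [vx vy].
    unfold pscal in E; simpl in E. injection E as Ex Ey. f_equal; lra. }
  rewrite (Opp _ _ E1) in T1. rewrite (Opp _ _ E2) in T2.
  apply (Hmeet (steiner N) (t + PI)); [exact T1|].
  replace (t + PI + turn o * alpha w) with (t + turn o * alpha w + PI) by ring.
  exact T2.
Qed.
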